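(* Let $A,B,C,\alpha_0,\gamma_0$ be real with $C>0$, let $m\ge1$ be an integer, and let $\beta_0=(m+1)C$. With $W,a,b,F_m,L_m$ as in the context, the return series satisfies, near $t=0$, $$W(t)=\frac{1}{m!\,C^m}\Big[\partial_t^m a(0,t)-mC\int_0^t\partial_t^m b(0,t-s)\,W(s)\,ds\Big].$$ Equivalently, $$W(t)=\frac{1}{m!\,C^m}\Big[F_m^{(m)}(t)-\int_0^t L_m^{(m)}(t-s)\,W(s)\,ds\Big].$$ If $F_m(t)=\sum_{n\ge0}f_n t^n/n!$ and $L_m(t)=\sum_{n\ge0}\lambda_n t^n/n!$, then $\lambda_{m-1}=m!\,C^m$, $W_0=1$, and for every $N\ge1$ $$W_N=\frac{1}{m!\,C^m}\Big[f_{N+m}-\sum_{q=1}^{N}\lambda_{m-1+q}\,W_{N-q}\Big].$$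
   Context: Original model: Motzkin paths start at height $0$, never go below $0$, and have step weights $\alpha_k=Ak+\alpha_0$ for $k\to k+1$, $\gamma_k=Bk+\gamma_0$ for $k\to k$, $\beta_k=Ck+\beta_0=C(k+m+1)$ for $k+1\to k$ ($k\ge0$; down-steps indexed by arrival height). The weight of a path is the product of its step weights (empty path: $1$). $W_n$ is the total weight of paths of length $n$ ending at height $0$, and $W(t)=\sum_{n\ge0}W_nt^n/n!$. Auxiliary shifted model on heights $j\ge0$: step weights $\widetilde\alpha_j=Aj+\alpha_0-mA$ for $j\to j+1$, $\widetilde\gamma_j=Bj+\gamma_0-mB$ for $j\to j$, $\widetilde\beta_j=C(j+1)$ for $j+1\to j$. $a_{n,j}$ (respectively $b_{n,j}$) is the total weight of auxiliary paths of length $n$ which start at height $m$ (respectively $m-1$), remain at heights $\ge0$, and end at height $j$; $a(x,t)=\sum_{n,j\ge0}a_{n,j}x^jt^n/n!$, $b(x,t)=\sum_{n,j\ge0}b_{n,j}x^jt^n/n!$. In the first formula $\partial_t^m b(0,t-s)$ means the $m$-th derivative of $u\mapsto b(0,u)$ evaluated at $u=t-s$. Let $X$ be the solution near $0$ of $X'=AX^2+BX+C$, $X(0)=0$, and put $$F_m(t)=X(t)^m\exp\Big(\int_0^t[(\alpha_0-mA)X(u)+\gamma_0-mB]\,du\Big),\qquad L_m(t)=\frac{mC\,F_m(t)}{X(t)},$$ both analytic at the origin (with the removable value at $t=0$). *)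

(* Defs.v *)
(* Stdlib/Coquelicot real numbers. *)
From Stdlib Require Export Reals List Arith.
From Coquelicot Require Export Coquelicot.
Export ListNotations.
Open Scope R_scope.

Inductive step : Set := Up | Level | Down.

Fixpoint words (n : nat) : list (list step) :=
  match n with
  | O => [[]]
  | S k => flat_map (fun p => [Up :: p; Level :: p; Down :: p]) (words k)
  end.

(* Down-steps are indexed by their arrival height. *)
Record step_weights := StepWeights {
  up_weight : nat -> R;
  level_weight : nat -> R;
  down_weight : nat -> R
}.

(* [None] when the path started at height [h] goes below 0. *)
Fixpoint end_height (h : nat) (p : list step) : option nat :=
  match p with
  | [] => Some h
  | Up :: q => end_height (S h) q
  | Level :: q => end_height h q
  | Down :: q => match h with O => None | S k => end_height k q end
  end.

Definition runs_from_to (i j : nat) (p : list step) : bool :=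
  match end_height i p with Some k => Nat.eqb k j | None => false end.

(* The value 0 for a path going below 0 is never used in [total_weight]. *)
Fixpoint path_weight (w : step_weights) (h : nat) (p : list step) : R :=
  match p with
  | [] => 1
  | Up :: q => up_weight w h * path_weight w (S h) q
  | Level :: q => level_weight w h * path_weight w h q
  | Down :: q =>
      match h with O => 0 | S k => down_weight w k * path_weight w k q end
  end.

Definition total_weight (w : step_weights) (n i j : nat) : R :=
  fold_right Rplus 0
    (map (path_weight w i) (filter (runs_from_to i j) (words n))).

Definition original_model (A B C alpha0 gamma0 beta0 : R) : step_weights :=
  StepWeights (fun k => A * INR k + alpha0)
              (fun k => B * INR k + gamma0)
              (fun k => C * INR k + beta0).

Definition auxiliary_model (A B C alpha0 gamma0 : R) (m : nat) : step_weights :=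
  StepWeights (fun j => A * INR j + alpha0 - INR m * A)
              (fun j => B * INR j + gamma0 - INR m * B)
              (fun j => C * (INR j + 1)).

Definition exp_coeff (u : nat -> R) (n : nat) : R := u n / INR (fact n).

Definition egf (u : nat -> R) (t : R) : R := PSeries (exp_coeff u) t.

Definition egf_converges (u : nat -> R) : Prop :=
  locally 0 (fun t => ex_pseries (exp_coeff u) t).

Definition has_egf (f : R -> R) (u : nat -> R) : Prop :=
  locally 0 (fun t => is_pseries (exp_coeff u) t (f t)).

Definition return_weight (A B C alpha0 gamma0 beta0 : R) (n : nat) : R :=
  total_weight (original_model A B C alpha0 gamma0 beta0) n 0 0.

Definition aux_weight (A B C alpha0 gamma0 : R) (m start n j : nat) : R :=
  total_weight (auxiliary_model A B C alpha0 gamma0 m) n start j.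

(* [row_sum c x n] is sum_j c n j * x^j.  For path weights the sum over j has
   finitely many nonzero terms. *)
Definition row_sum (c : nat -> nat -> R) (x : R) (n : nat) : R :=
  PSeries (c n) x.

Definition bivariate_egf (c : nat -> nat -> R) (x t : R) : R :=
  egf (row_sum c x) t.

Definition riccati_solution (A B C : R) (X : R -> R) : Prop :=
  X 0 = 0 /\
  locally 0 (fun t => is_derive X t (A * X t ^ 2 + B * X t + C)).

Definition F_fun (A B alpha0 gamma0 : R) (m : nat) (X : R -> R) (t : R) : R :=
  X t ^ m *
  exp (RInt (fun u => (alpha0 - INR m * A) * X u + gamma0 - INR m * B) 0 t).

Definition L_quotient (A B C alpha0 gamma0 : R) (m : nat) (X : R -> R)
    (t : R) : R :=
  INR m * C * F_fun A B alpha0 gamma0 m X t / X t.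

(* At t = 0, where X vanishes, the removable value: [Lim] is taken over a
   punctured neighbourhood. *)
Definition L_fun (A B C alpha0 gamma0 : R) (m : nat) (X : R -> R)
    (t : R) : R :=
  if Req_EM_T t 0 then real (Lim (L_quotient A B C alpha0 gamma0 m X) 0)
  else L_quotient A B C alpha0 gamma0 m X t.

(* Main.v *)
Require Import Defs.
From Stdlib Require Import Lra Lia.

(** Raising all heights of the original model by [m] turns it into the part of
    the auxiliary model above height [m]: there the down-step from [k + 1 + m]
    to [k + m] weighs [C * (k + m + 1)], which is what the value of [beta0]
    says.  An auxiliary path from [m] to 0 must at some time step from [m] to
    [m - 1] for the first time.  Before that step it is a raised return path,
    the step weighs [m * C], and after it the path goes from [m - 1] to 0.
    Hence the path sums satisfy
    [a (n + 1) = m C * sum_k W k * b (n - k)] ([first_passage]).  Since [b]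
    starts with [m - 1] zeros, followed by [(m - 1)! C ^ (m - 1)], the
    equation can be solved for [W N] at [n + 1 = N + m]
    ([return_weight_recurrence]).  This is the recursion of the corollary.

    The sum in it is an ordinary convolution of sequences, not a binomial one.
    Because of the Beta integral of [(t - s) ^ p / p! * s ^ q / q!] it is
    exactly what the convolution integral of two exponential generating
    functions produces ([is_RInt_egf_convolution]), which gives the first
    integral formula.

    For the closed form, let [F_h] be the product of [X ^ h] and the
    exponential factor.  The Riccati equation makes [F_h'] the combination of
    [F_(h+1)], [F_h] and [F_(h-1)] whose coefficients are the weights of the
    steps leaving height [h]; the generating functions of the paths from [h] to
    0 satisfy the same system with the same initial values.  The weights grow
    linearly in the height, so the n-th derivatives of a bounded solution are at
    most of order [n!] times a geometric factor, and Taylor's formula identifies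
    the two ([bounded_solution_egf], [riccati_family_egf]).  Thus [F_m] and
    [F_(m-1)] generate [a] and [b], and [L_m = m C F_(m-1)]. *)

(** * Neighbourhoods of the origin *)

Lemma radius_locally (P : R -> Prop) delta x :
  Rabs x < delta -> (forall t, Rabs t < delta -> P t) -> locally x P.
Proof.
  intros Hx H. assert (Hp : 0 < delta - Rabs x) by lra.
  exists (mkposreal _ Hp); intros t Ht. apply H.
  change (Rabs (t - x) < delta - Rabs x) in Ht.
  pose proof (Rabs_triang_inv t x). lra.
Qed.

Lemma locally_0_radius (P : R -> Prop) :
  locally 0 P -> exists delta, 0 < delta /\ forall t, Rabs t < delta -> P t.
Proof.
  intros [e He]. exists e. split; [apply cond_pos|].
  intros t Ht. apply He. change (Rabs (t - 0) < e). rewrite Rminus_0_r. exact Ht.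
Qed.

Lemma between_0_Rabs s t :
  Rmin 0 t <= s <= Rmax 0 t -> Rabs s <= Rabs t /\ Rabs (t - s) <= Rabs t.
Proof.
  unfold Rmin, Rmax, Rabs.
  destruct (Rle_dec 0 t), (Rcase_abs t), (Rcase_abs s), (Rcase_abs (t - s)); lra.
Qed.

(** * Series with factorially bounded coefficients *)

(** The coefficients of an exponential generating function whose radius of
    convergence is at least [1 / r], with the constant kept explicit so that it
    can be followed through shifts and delays. *)
Definition factorial_bound (K r : R) (u : nat -> R) : Prop :=
  0 <= K /\ forall n, Rabs (u n) <= K * r ^ n * INR (fact n).

(** On generating functions [shift] is differentiation and [delay], defined
    next, is integration from 0. *)
Definition shift (n : nat) (u : nat -> R) (k : nat) : R := u (n + k)%nat.

Definition delay (n : nat) (u : nat -> R) (k : nat) : R :=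
  if (k <? n)%nat then 0 else u (k - n)%nat.

Lemma fact_mul_le n k : (fact n * fact k <= fact (n + k))%nat.
Proof.
  induction n as [|n IH]; simpl; [lia|].
  pose proof (Nat.mul_le_mono_l _ _ n IH).
  pose proof (lt_O_fact (n + k)). nia.
Qed.

Lemma fact_add_le n k :
  (fact (n + k) <= 2 ^ (n + k) * (fact n * fact k))%nat.
Proof.
  assert (H1 : forall j, (1 <= 2 ^ j)%nat)
    by (intro j; pose proof (Nat.pow_nonzero 2 j); lia).
  revert k; induction n as [|n IHn]; intro k.
  - specialize (H1 k). pose proof (lt_O_fact k). simpl. nia.
  - induction k as [|k IHk].
    + replace (S n + 0)%nat with (S n) by lia.
      specialize (H1 (S n)). pose proof (lt_O_fact (S n)).
      change (fact 0) with 1%nat. nia.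
    + specialize (IHn (S k)).
      (* Pascal's rule, multiplied by the factorials. *)
      replace (S n + S k)%nat with (S (S n + k)) by lia.
      replace (n + S k)%nat with (S n + k)%nat in IHn by lia.
      rewrite fact_simpl, Nat.pow_succ_r'.
      rewrite (fact_simpl n), (fact_simpl k) in *.
      set (a := fact n) in *; set (b := fact k) in *.
      set (p := (2 ^ (S n + k))%nat) in *.
      set (f := fact (S n + k)) in *.
      apply (Nat.mul_le_mono_l _ _ (S n)) in IHn.
      apply (Nat.mul_le_mono_l _ _ (S k)) in IHk.
      nia.
Qed.

Lemma INR_fact_mul_le n k : INR (fact n) * INR (fact k) <= INR (fact (n + k)).
Proof. rewrite <- mult_INR. apply le_INR, fact_mul_le. Qed.

Lemma INR_fact_add_le n k :
  INR (fact (n + k)) <= 2 ^ (n + k) * (INR (fact n) * INR (fact k)).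
Proof.
  rewrite <- mult_INR. change 2 with (INR 2). rewrite <- pow_INR, <- mult_INR.
  apply le_INR, fact_add_le.
Qed.

(** In a convolution integral the factor [n!] in the constant is cancelled by the
    one that [factorial_bound_delay] gains. *)
Lemma factorial_bound_shift K r u n :
  0 <= r -> factorial_bound K r u ->
  factorial_bound (K * (2 * r) ^ n * INR (fact n)) (2 * r) (shift n u).
Proof.
  intros Hr [HK H]; split.
  - apply Rmult_le_pos; [apply Rmult_le_pos; [lra | apply pow_le; lra]
                        | apply pos_INR].
  - intro k; unfold shift.
    eapply Rle_trans; [apply H|].
    pose proof (INR_fact_add_le n k) as Hf.
    assert (0 <= K * r ^ (n + k)) by (apply Rmult_le_pos; [lra | apply pow_le; lra]).
    eapply Rle_trans; [apply Rmult_le_compat_l; [assumption | apply Hf]|].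
    apply Req_le. rewrite !Rpow_mult_distr, !pow_add. ring.
Qed.

Lemma factorial_bound_delay K r u n :
  1 <= r -> factorial_bound K r u ->
  factorial_bound (K / (r ^ n * INR (fact n))) r (delay n u).
Proof.
  intros Hr [HK H].
  assert (Hrn : 0 < r ^ n) by (apply pow_lt; lra).
  pose proof (INR_fact_lt_0 n) as Hn.
  assert (Hi : 0 <= K / (r ^ n * INR (fact n)))
    by (apply Rdiv_le_0_compat; [lra | apply Rmult_lt_0_compat; lra]).
  split; [exact Hi|].
  intro k; unfold delay. destruct (Nat.ltb_spec k n) as [Hk|Hk].
  - rewrite Rabs_R0. apply Rmult_le_pos; [|apply pos_INR].
    apply Rmult_le_pos; [exact Hi | apply pow_le; lra].
  - eapply Rle_trans; [apply H|].
    pose proof (INR_fact_mul_le n (k - n)) as Hf.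
    replace (n + (k - n))%nat with k in Hf by lia.
    replace (r ^ k) with (r ^ n * r ^ (k - n))
      by (rewrite <- pow_add; f_equal; lia).
    replace (K / (r ^ n * INR (fact n)) * (r ^ n * r ^ (k - n)) * INR (fact k))
      with (K * r ^ (k - n) * (INR (fact k) / INR (fact n)))
      by (field; split; lra).
    apply Rmult_le_compat_l.
    + apply Rmult_le_pos; [lra | apply pow_le; lra].
    + apply Rle_div_r; lra.
Qed.

Lemma factorial_bound_weaken K K' r r' u :
  K <= K' -> 0 <= r <= r' -> factorial_bound K r u -> factorial_bound K' r' u.
Proof.
  intros HK [Hr Hr'] [H0 H]; split; [lra|].
  intro n; eapply Rle_trans; [apply H|].
  apply Rmult_le_compat_r; [apply pos_INR|].
  apply Rmult_le_compat; [lra | apply pow_le; lra | lra |].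
  apply pow_incr; lra.
Qed.

Lemma factorial_bound_ext K r u v :
  (forall n, u n = v n) -> factorial_bound K r u -> factorial_bound K r v.
Proof. intros E [H0 H]; split; [exact H0|]. intro n; rewrite <- E; apply H. Qed.

Lemma exp_coeff_bound K r u n :
  factorial_bound K r u -> Rabs (exp_coeff u n) <= K * r ^ n.
Proof.
  intros [_ H]; unfold exp_coeff.
  pose proof (INR_fact_lt_0 n).
  rewrite Rabs_div by lra. rewrite (Rabs_pos_eq (INR _)) by lra.
  apply Rle_div_l; [lra | apply H].
Qed.

Lemma egf_radius K r u t :
  0 < r -> factorial_bound K r u -> r * Rabs t < 1 ->
  Rbar_lt (Rabs t) (CV_radius (exp_coeff u)).
Proof.
  intros Hr H Ht.
  apply Rbar_lt_le_trans with (Finite (/ r)).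
  - simpl. apply Rmult_lt_reg_l with r; [lra|]. rewrite Rinv_r; lra.
  - apply CV_radius_bounded. exists K; intro n.
    rewrite Rabs_mult, <- RPow_abs, (Rabs_pos_eq (/ r))
      by (left; apply Rinv_0_lt_compat; lra).
    replace K with (K * r ^ n * (/ r) ^ n)
      by (rewrite Rmult_assoc, <- Rpow_mult_distr, Rinv_r, pow1; lra).
    apply Rmult_le_compat_r.
    + apply pow_le. left; apply Rinv_0_lt_compat; lra.
    + apply exp_coeff_bound, H.
Qed.

(** After [t ^ N] is factored out, the series is dominated by a geometric one
    whose ratio [r * |t|] is at most 1/2; this is where the 2 comes from. *)
Lemma egf_small K r u N t :
  0 < r -> factorial_bound K r u -> (forall n, (n < N)%nat -> u n = 0) ->
  2 * (r * Rabs t) <= 1 -> Rabs (egf u t) <= 2 * K * (r * Rabs t) ^ N.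
Proof.
  intros Hr H H0 Ht. pose proof (Rabs_pos t) as Htp.
  assert (HK := proj1 H).
  set (q := r * Rabs t) in *.
  assert (Hq : 0 <= q) by (unfold q; nra).
  unfold egf.
  replace (PSeries (exp_coeff u) t)
    with (t ^ N * PSeries (fun k => exp_coeff u (N + k)) t).
  2:{ rewrite <- PSeries_incr_n. apply PSeries_ext; intro n.
      rewrite PS_incr_n_simplify. destruct (le_lt_dec N n) as [h|h].
      - f_equal; lia.
      - unfold exp_coeff; rewrite (H0 n h). unfold Rdiv; rewrite Rmult_0_l.
        reflexivity. }
  assert (Hterm : forall k, Rabs (exp_coeff u (N + k) * t ^ k)
                            <= K * r ^ N * q ^ k).
  { intro k. rewrite Rabs_mult, <- RPow_abs.
    unfold q; rewrite Rpow_mult_distr.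
    replace (K * r ^ N * (r ^ k * Rabs t ^ k))
      with (K * r ^ (N + k) * Rabs t ^ k) by (rewrite pow_add; ring).
    apply Rmult_le_compat_r; [apply pow_le; lra | apply exp_coeff_bound, H]. }
  assert (Hex : ex_series (fun k => K * r ^ N * q ^ k)).
  { apply (ex_series_scal (K := R_AbsRing) (V := R_NormedModule)).
    apply ex_series_geom. rewrite Rabs_pos_eq; lra. }
  assert (Hs : Rabs (PSeries (fun k => exp_coeff u (N + k)) t) <= K * r ^ N * 2).
  { unfold PSeries.
    eapply Rle_trans; [apply Series_Rabs|].
    - apply (ex_series_le (K := R_AbsRing) (V := R_CompleteNormedModule) _
               (fun k => K * r ^ N * q ^ k)); [|exact Hex].
      intro n. unfold norm; simpl. unfold abs; simpl.
      rewrite Rabs_Rabsolu. apply Hterm.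
    - eapply Rle_trans; [apply Series_le; [|exact Hex]|].
      + intro n; split; [apply Rabs_pos | apply Hterm].
      + rewrite Series_scal_l, Series_geom by (rewrite Rabs_pos_eq; lra).
        apply Rmult_le_compat_l.
        * apply Rmult_le_pos; [lra | apply pow_le; lra].
        * rewrite <- (Rinv_inv 2). apply Rinv_le_contravar; lra. }
  rewrite Rabs_mult, <- RPow_abs.
  eapply Rle_trans; [apply Rmult_le_compat_l; [apply pow_le; lra | apply Hs]|].
  apply Req_le. unfold q. rewrite Rpow_mult_distr. ring.
Qed.

Lemma egf_0 u : egf u 0 = u 0%nat.
Proof. unfold egf; rewrite PSeries_0; unfold exp_coeff; simpl; field. Qed.

Lemma egf_ext u v t : (forall n, u n = v n) -> egf u t = egf v t.
Proof.
  intro H; apply PSeries_ext; intro n; unfold exp_coeff; rewrite H; reflexivity.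
Qed.

Lemma egf_lincomb u v w a b t :
  (forall n, w n = a * u n + b * v n) ->
  Rbar_lt (Rabs t) (CV_radius (exp_coeff u)) ->
  Rbar_lt (Rabs t) (CV_radius (exp_coeff v)) ->
  egf w t = a * egf u t + b * egf v t.
Proof.
  intros Hw Hu Hv. unfold egf at 1.
  rewrite (PSeries_ext _
    (PS_plus (PS_scal a (exp_coeff u)) (PS_scal b (exp_coeff v)))).
  - rewrite PSeries_plus, !PSeries_scal; [reflexivity | |];
      (apply ex_pseries_scal; [apply Rmult_comm | apply CV_radius_inside; assumption]).
  - intro k. unfold exp_coeff at 1. rewrite Hw.
    unfold PS_plus, PS_scal, exp_coeff, plus, scal; simpl.
    unfold mult; simpl. unfold Rdiv. ring.
Qed.

Lemma Derive_n_egf u m t :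
  Rbar_lt (Rabs t) (CV_radius (exp_coeff u)) ->
  Derive_n (egf u) m t = egf (shift m u) t.
Proof.
  intro H. unfold egf. rewrite Derive_n_PSeries by exact H.
  apply PSeries_ext; intro k. unfold PS_derive_n, exp_coeff, shift.
  rewrite (Nat.add_comm k m).
  pose proof (INR_fact_lt_0 (m + k)). pose proof (INR_fact_lt_0 k).
  field; split; lra.
Qed.

Lemma is_derive_egf u t :
  Rbar_lt (Rabs t) (CV_radius (exp_coeff u)) ->
  is_derive (egf u) t (egf (shift 1 u) t).
Proof.
  intro H. replace (egf (shift 1 u) t) with (PSeries (PS_derive (exp_coeff u)) t).
  - apply is_derive_PSeries, H.
  - apply PSeries_ext; intro k. unfold PS_derive, exp_coeff, shift.
    change (1 + k)%nat with (S k). rewrite fact_simpl, mult_INR.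
    pose proof (INR_fact_lt_0 k). assert (INR (S k) <> 0) by (apply not_0_INR; lia).
    field; split; lra.
Qed.

(** * Convolution integrals of exponential generating functions *)

Lemma eq_0_of_geometric_bound c x :
  (forall n, Rabs x <= c * (1 / 2) ^ n) -> x = 0.
Proof.
  intro H. assert (Hx : Rabs x <= 0).
  { apply (is_lim_seq_le (fun _ => Rabs x) (fun n => c * (1 / 2) ^ n)
             (Finite (Rabs x)) (Finite 0)).
    - exact H.
    - apply is_lim_seq_const.
    - replace (Finite 0) with (Rbar_mult c 0) by (simpl; f_equal; ring).
      apply is_lim_seq_scal_l, is_lim_seq_geom.
      rewrite Rabs_pos_eq; lra. }
  destruct (Req_dec x 0) as [|Hn]; [assumption|].
  apply Rabs_pos_lt in Hn. lra.
Qed.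

(** The index is one more than in the Cauchy product: the integral of
    [(t - s) ^ p / p! * s ^ q / q!] over [s] from 0 to [t] is
    [t ^ (p + q + 1) / (p + q + 1)!]. *)
Definition convolution (u v : nat -> R) (n : nat) : R :=
  match n with
  | O => 0
  | S k => sum_n (fun j => u (k - j)%nat * v j) k
  end.

Lemma delay_S n v k : delay (S n) v (S k) = delay n v k.
Proof. reflexivity. Qed.

Lemma convolution_0 u v n :
  convolution (shift 0 u) (delay 0 v) n = convolution u v n.
Proof.
  destruct n as [|n]; [reflexivity|]. apply sum_n_ext; intro j.
  unfold shift, delay; simpl. do 2 f_equal; lia.
Qed.

(** The discrete counterpart of one integration by parts. *)
Lemma convolution_split u v n k :
  convolution (shift n u) (delay n v) k =
  u n * delay (S n) v k + convolution (shift (S n) u) (delay (S n) v) k.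
Proof.
  destruct k as [|k].
  - simpl. unfold delay; simpl. ring.
  - rewrite delay_S. unfold convolution.
    destruct k as [|k].
    + rewrite !sum_O. unfold shift. rewrite Nat.add_0_r.
      unfold delay at 3; simpl. ring.
    + rewrite sum_Sn. unfold sum_n at 2. rewrite sum_Sn_m by lia.
      rewrite <- sum_n_m_S. unfold plus; simpl.
      replace (delay (S n) v 0) with 0 by reflexivity.
      rewrite Nat.sub_diag. unfold shift at 2. rewrite Nat.add_0_r.
      rewrite Rmult_0_r, Rplus_0_l, Rplus_comm. f_equal.
      apply sum_n_m_ext_loc; intros j Hj. rewrite delay_S.
      unfold shift. apply (f_equal (fun i => u i * _)). destruct j; lia.
Qed.

Lemma convolution_delay_low u v n k :
  (k <= n)%nat -> convolution u (delay n v) k = 0.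
Proof.
  intro Hk. destruct k as [|k]; [reflexivity|]. unfold convolution.
  rewrite (sum_n_ext_loc _ (fun _ => 0)).
  - rewrite sum_n_const. ring.
  - intros j Hj. unfold delay. destruct (Nat.ltb_spec j n); [apply Rmult_0_r | lia].
Qed.

(** Each of the [k + 1] products in the entry of index [k + 1] is at most
    [K ^ 2 * r ^ k * k!], and [(k + 1) * k! = (k + 1)!]. *)
Lemma factorial_bound_convolution K r u v n :
  1 <= r -> factorial_bound K r u -> factorial_bound K r v ->
  factorial_bound (K ^ 2) r (convolution (shift n u) (delay n v)).
Proof.
  intros Hr [HK Hu] [_ Hv]. split; [nra|].
  intros [|k].
  - simpl. rewrite Rabs_R0. nra.
  - unfold convolution.
    assert (Hterm : forall j, (j <= k)%nat ->
      Rabs (shift n u (k - j) * delay n v j) <= K ^ 2 * r ^ k * INR (fact k)).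
    { intros j Hj. rewrite Rabs_mult. unfold shift, delay.
      destruct (Nat.ltb_spec j n) as [h|h].
      - rewrite Rabs_R0, Rmult_0_r. apply Rmult_le_pos; [|apply pos_INR].
        apply Rmult_le_pos; [nra | apply pow_le; lra].
      - eapply Rle_trans; [apply Rmult_le_compat; try apply Rabs_pos;
                           [apply Hu | apply Hv]|].
        pose proof (INR_fact_mul_le (n + (k - j)) (j - n)) as Hf.
        replace (n + (k - j) + (j - n))%nat with k in Hf by lia.
        replace (r ^ k) with (r ^ (n + (k - j)) * r ^ (j - n))
          by (rewrite <- pow_add; f_equal; lia).
        replace (K * r ^ (n + (k - j)) * INR (fact (n + (k - j))) *
                 (K * r ^ (j - n) * INR (fact (j - n))))
          with (K ^ 2 * (r ^ (n + (k - j)) * r ^ (j - n)) *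
                (INR (fact (n + (k - j))) * INR (fact (j - n)))) by ring.
        apply Rmult_le_compat_l; [|exact Hf].
        apply Rmult_le_pos; [nra|].
        apply Rmult_le_pos; apply pow_le; lra. }
    eapply Rle_trans.
    + apply (norm_sum_n_m (K := R_AbsRing) (V := R_NormedModule)).
    + rewrite (sum_n_m_ext_loc _
        (fun j => norm (if (j <=? k)%nat then shift n u (k - j) * delay n v j else 0))).
      2:{ intros j Hj. destruct (Nat.leb_spec j k); [reflexivity | lia]. }
      eapply Rle_trans.
      * apply sum_n_m_le with (b := fun _ => K ^ 2 * r ^ k * INR (fact k)).
        intro j. destruct (Nat.leb_spec j k) as [h|h]; [apply Hterm, h|].
        unfold norm; simpl; unfold abs; simpl. rewrite Rabs_R0.
        apply Rmult_le_pos; [|apply pos_INR].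
        apply Rmult_le_pos; [nra | apply pow_le; lra].
      * rewrite sum_n_m_const, Nat.sub_0_r.
        rewrite fact_simpl, mult_INR.
        assert (Hp : r ^ k <= r ^ S k) by (apply Rle_pow; [lra | lia]).
        assert (H0 : 0 <= INR (S k) * INR (fact k) * K ^ 2).
        { apply Rmult_le_pos; [apply Rmult_le_pos; apply pos_INR | nra]. }
        nra.
Qed.

(** Both sides obey the same recursion: integration by parts, which
    differentiates the generating function of [u] and integrates that of [v],
    and [convolution_split] peel off the same term and leave an expression of
    the same shape for [shift n u] and [delay n v].  The remaining integral and
    the remaining convolution tend to 0 geometrically, so the two sides agree. *)
Theorem is_RInt_egf_convolution K r u v t :
  1 <= r -> factorial_bound K r u -> factorial_bound K r v ->
  8 * (r * Rabs t) <= 1 ->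
  is_RInt (fun s => egf u (t - s) * egf v s) 0 t (egf (convolution u v) t).
Proof.
  intros Hr Hu Hv Ht. assert (HK := proj1 Hu).
  pose proof (Rabs_pos t) as Htp.
  (* [U n] is the [n]-th derivative of the generating function of [u], and
     [V n] the [n]-fold antiderivative of that of [v]. *)
  set (U n := egf (shift n u)). set (V n := egf (delay n v)).
  assert (HU : forall n x, Rabs x <= Rabs t -> is_derive (U n) x (U (S n) x)).
  { intros n x Hx. unfold U.
    rewrite (egf_ext (shift (S n) u) (shift 1 (shift n u)))
      by (intro k; unfold shift; f_equal; lia).
    apply is_derive_egf.
    eapply egf_radius; [|apply (factorial_bound_shift K r u n); [lra | exact Hu]|]; nra. }
  assert (HV : forall n x, Rabs x <= Rabs t -> is_derive (V (S n)) x (V n x)).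
  { intros n x Hx. unfold V.
    rewrite (egf_ext (delay n v) (shift 1 (delay (S n) v))) by reflexivity.
    apply is_derive_egf.
    eapply egf_radius; [|apply (factorial_bound_delay K r v (S n)); [lra | exact Hv]|]; nra. }
  assert (HV0 : forall n x, Rabs x <= Rabs t -> ex_derive (V n) x).
  { intros n x Hx. eexists. apply is_derive_egf.
    eapply egf_radius; [|apply (factorial_bound_delay K r v n); [lra | exact Hv]|]; nra. }
  assert (Hcont : forall n s, Rmin 0 t <= s <= Rmax 0 t ->
                              continuous (fun s => U n (t - s) * V n s) s).
  { intros n s Hs. destruct (between_0_Rabs s t Hs) as [H1 H2].
    apply (ex_derive_continuous (K := R_AbsRing) (V := R_NormedModule)).
    apply (ex_derive_mult (fun s => U n (t - s)) (V n)).
    - apply (ex_derive_comp (U n) (fun s => t - s)).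
      + eexists; apply HU, H2.
      + auto_derive; trivial.
    - apply HV0, H1. }
  set (C n := egf (convolution (shift n u) (delay n v)) t).
  set (J n := RInt (fun s => U n (t - s) * V n s) 0 t).
  assert (HVS0 : forall n, V (S n) 0 = 0) by (intro n; unfold V; rewrite egf_0; reflexivity).
  assert (HJ : forall n, J n = u n * V (S n) t + J (S n)).
  { intro n. unfold J.
    assert (Hd : is_RInt (fun s => - (U (S n) (t - s) * V (S n) s) + U n (t - s) * V n s)
                   0 t (minus (U n (t - t) * V (S n) t) (U n (t - 0) * V (S n) 0))).
    { apply (is_RInt_derive (fun s => U n (t - s) * V (S n) s)).
      - intros s Hs. destruct (between_0_Rabs s t Hs) as [H1 H2].
        evar_last.
        + apply (is_derive_mult (fun s => U n (t - s)) (V (S n)) s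
                   (- U (S n) (t - s)) (V n s)).
          * evar_last.
            -- apply (is_derive_comp (U n) (fun s => t - s));
                 [apply HU, H2 | auto_derive; [trivial | reflexivity]].
            -- unfold scal; simpl; unfold mult; simpl; ring.
          * apply HV, H1.
          * intros a b; apply Rmult_comm.
        + unfold plus, mult; simpl. ring.
      - intros s Hs.
        apply (continuous_plus (fun s => - (U (S n) (t - s) * V (S n) s))).
        + apply (continuous_opp (fun s => U (S n) (t - s) * V (S n) s)), Hcont, Hs.
        + apply Hcont, Hs. }
    apply (is_RInt_unique (V := R_CompleteNormedModule)) in Hd.
    rewrite (RInt_plus (fun s => - (U (S n) (t - s) * V (S n) s))) in Hd.
    - rewrite (RInt_opp (fun s => U (S n) (t - s) * V (S n) s)) in Hd.
      + rewrite HVS0, Rminus_diag in Hd.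
        replace (U n 0) with (u n) in Hd
          by (unfold U; rewrite egf_0; unfold shift; f_equal; lia).
        unfold plus, opp, minus in Hd; simpl in Hd.
        unfold plus, opp in Hd; simpl in Hd. lra.
      + apply (ex_RInt_continuous (V := R_CompleteNormedModule)); intros; apply Hcont; assumption.
    - apply (ex_RInt_opp (fun s => U (S n) (t - s) * V (S n) s)).
      apply (ex_RInt_continuous (V := R_CompleteNormedModule)); intros; apply Hcont; assumption.
    - apply (ex_RInt_continuous (V := R_CompleteNormedModule)); intros; apply Hcont; assumption. }
  assert (HC : forall n, C n = u n * V (S n) t + C (S n)).
  { intro n. unfold C, V.
    rewrite <- (Rmult_1_l (egf (convolution (shift (S n) u) _) t)).
    apply egf_lincomb.
    - intro k. rewrite Rmult_1_l. apply convolution_split.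
    - eapply egf_radius; [|apply (factorial_bound_delay K r v (S n)); [lra | exact Hv]|]; nra.
    - eapply egf_radius;
        [|apply (factorial_bound_convolution K r u v (S n)); [lra | exact Hu | exact Hv]|]; nra. }
  assert (HD : forall n, J 0%nat - C 0%nat = J n - C n).
  { induction n as [|n IH]; [reflexivity|].
    rewrite IH, HJ, HC. ring. }
  assert (Hhalf : forall n x, 0 <= x <= 1 / 2 -> x ^ n <= (1 / 2) ^ n)
    by (intros; apply pow_incr; lra).
  assert (HCb : forall n, Rabs (C n) <= 2 * K ^ 2 * (1 / 2) ^ n).
  { intro n. unfold C.
    eapply Rle_trans; [apply (egf_small (K ^ 2) r _ n)|].
    - lra.
    - apply factorial_bound_convolution; assumption.
    - intros k Hk. apply convolution_delay_low. lia.
    - lra.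
    - apply Rmult_le_compat_l; [nra|]. apply Hhalf; nra. }
  assert (HJb : forall n, Rabs (J n) <= Rabs t * (4 * K ^ 2 * (1 / 2) ^ n)).
  { intro n.
    replace (Rabs t) with (Rabs (t - 0)) by (rewrite Rminus_0_r; reflexivity).
    apply (norm_RInt_le_const_abs (fun s => U n (t - s) * V n s)).
    2:{ apply (RInt_correct (fun s => U n (t - s) * V n s)).
        apply (ex_RInt_continuous (V := R_CompleteNormedModule)); intros; apply Hcont; assumption. }
    intros s Hs. destruct (between_0_Rabs s t Hs) as [H1 H2].
    pose proof (Rabs_pos s). pose proof (INR_fact_lt_0 n) as Hn.
    assert (Hrn : 0 < r ^ n) by (apply pow_lt; lra).
    (* The factors [n!] and [r ^ n] of the two bounds cancel. *)
    assert (HUb : Rabs (U n (t - s)) <= 2 * (K * (2 * r) ^ n * INR (fact n)) * 1).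
    { apply (egf_small _ (2 * r) _ 0); [lra| | intros; lia | nra].
      apply factorial_bound_shift; [lra | exact Hu]. }
    assert (HVb : Rabs (V n s) <= 2 * (K / (r ^ n * INR (fact n))) * (r * Rabs s) ^ n).
    { apply (egf_small _ r); [lra | | | nra].
      - apply factorial_bound_delay; assumption.
      - intros k Hk. unfold delay. destruct (Nat.ltb_spec k n); [reflexivity | lia]. }
    unfold norm; simpl; unfold abs; simpl. rewrite Rabs_mult.
    eapply Rle_trans;
      [apply Rmult_le_compat; [apply Rabs_pos | apply Rabs_pos | apply HUb | apply HVb]|].
    replace (2 * (K * (2 * r) ^ n * INR (fact n)) * 1 *
             (2 * (K / (r ^ n * INR (fact n))) * (r * Rabs s) ^ n))
      with (4 * K ^ 2 * (2 * (r * Rabs s)) ^ n).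
    - apply Rmult_le_compat_l; [nra|]. apply Hhalf; nra.
    - rewrite !Rpow_mult_distr. field; lra. }
  assert (Hzero : J 0%nat - C 0%nat = 0).
  { apply (eq_0_of_geometric_bound (6 * K ^ 2)). intro n. rewrite (HD n).
    eapply Rle_trans; [apply Rabs_triang|]. rewrite Rabs_Ropp.
    specialize (HCb n). specialize (HJb n).
    assert (0 <= K ^ 2 * (1 / 2) ^ n) by (apply Rmult_le_pos; [nra | apply pow_le; lra]).
    assert (Rabs t <= 1) by nra.
    nra. }
  apply Rminus_diag_uniq in Hzero.
  unfold J, C, U, V in Hzero.
  rewrite <- (egf_ext _ _ t (convolution_0 u v)), <- Hzero.
  apply (is_RInt_ext (fun s => U 0%nat (t - s) * V 0%nat s)).
  - intros s _. apply (f_equal (Rmult _)), egf_ext. intro k.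
    unfold delay; simpl. f_equal; lia.
  - apply (RInt_correct (fun s => U 0%nat (t - s) * V 0%nat s)).
    apply (ex_RInt_continuous (V := R_CompleteNormedModule)); intros; apply Hcont; assumption.
Qed.

(** * Splitting convolution sums *)

Lemma sum_n_split_first (f : nat -> R) N :
  sum_n f (S N) = f 0%nat + sum_n (fun j => f (S j)) N.
Proof. unfold sum_n. rewrite sum_Sn_m by lia. rewrite sum_n_m_S. reflexivity. Qed.

Lemma sum_n_rev (f : nat -> R) N : sum_n (fun j => f (N - j)%nat) N = sum_n f N.
Proof.
  induction N as [|N IH]; [rewrite !sum_O; reflexivity|].
  rewrite sum_n_split_first, sum_Sn, <- IH. apply Rplus_comm.
Qed.

Lemma sum_n_extend (f : nat -> R) N n :
  (forall j, (N < j <= N + n)%nat -> f j = 0) -> sum_n f (N + n) = sum_n f N.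
Proof.
  intro H; induction n as [|n IH]; [f_equal; lia|].
  rewrite Nat.add_succ_r, sum_Sn, IH, H by (intros; try apply H; lia).
  apply Rplus_0_r.
Qed.

Lemma convolution_lincomb u x y z a b c v n :
  (forall j, v j = a * x j + b * y j + c * z j) ->
  convolution u v n =
  a * convolution u x n + b * convolution u y n + c * convolution u z n.
Proof.
  intro H. destruct n as [|n]; [simpl; ring|]. unfold convolution.
  rewrite (sum_n_ext _ (fun j =>
    plus (plus (mult a (u (n - j)%nat * x j)) (mult b (u (n - j)%nat * y j)))
         (mult c (u (n - j)%nat * z j)))).
  - rewrite !sum_n_plus, !(sum_n_mult_l (K := R_Ring)). reflexivity.
  - intro j. rewrite H. unfold plus, mult; simpl. ring.
Qed.

Lemma convolution_S u v n :
  convolution u v (S n) = u n * v 0%nat + convolution u (shift 1 v) n.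
Proof.
  unfold convolution at 1. destruct n as [|n].
  - rewrite sum_O. simpl. ring.
  - rewrite sum_n_split_first. reflexivity.
Qed.

(** With [n] leading zeros in [u] only the first [N + 1] terms survive; the last
    of them isolates [v N]. *)
Lemma convolution_leading_zeros u v n N :
  (forall k, (k < n)%nat -> u k = 0) ->
  convolution u v (N + S n) = u n * v N + convolution (shift (S n) u) v N.
Proof.
  intro H. rewrite Nat.add_succ_r. unfold convolution at 1.
  rewrite sum_n_extend.
  2:{ intros j Hj. rewrite H by lia. apply Rmult_0_l. }
  destruct N as [|N].
  - rewrite sum_O. simpl. rewrite Nat.sub_0_r. ring.
  - rewrite sum_Sn, Rplus_comm. unfold convolution. unfold plus; simpl. f_equal.
    + apply (f_equal (fun i => u i * _)). destruct n; lia.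
    + apply sum_n_ext_loc; intros j Hj. unfold shift.
      apply (f_equal (fun i => u i * _)). destruct j; lia.
Qed.

Lemma convolution_shift_sum u v n N :
  convolution (shift (S n) u) v N =
  sum_n_m (fun q => u (n + q)%nat * v (N - q)%nat) 1 N.
Proof.
  destruct N as [|N]; [rewrite sum_n_m_zero by lia; reflexivity|].
  rewrite <- sum_n_m_S. simpl. fold (sum_n (fun q => u (n + S q)%nat * v (N - q)%nat) N).
  rewrite <- sum_n_rev. apply sum_n_ext_loc; intros j Hj.
  unfold shift. apply (f_equal (fun i => u i * _)). lia.
Qed.

(** * Path sums and the first-step recursion *)

(** The generator of the walk, acting on functions of the starting height. *)
Definition first_step (w : step_weights) (u : nat -> R) (i : nat) : R :=
  up_weight w i * u (S i) + level_weight w i * u i +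
  match i with O => 0 | S k => down_weight w k * u k end.

Lemma total_weight_0 w i j : total_weight w 0 i j = if (i =? j)%nat then 1 else 0.
Proof.
  unfold total_weight, runs_from_to; simpl.
  destruct (i =? j)%nat; simpl; ring.
Qed.

Lemma total_weight_S w n i j :
  total_weight w (S n) i j = first_step w (fun h => total_weight w n h j) i.
Proof.
  unfold total_weight, first_step; simpl.
  induction (words n) as [|p l IH]; simpl.
  - destruct i; ring.
  - unfold runs_from_to in *; simpl in *.
    destruct i as [|i];
      repeat match goal with
        |- context [end_height ?h p] => destruct (end_height h p); simpl end;
      repeat match goal with
        |- context [(?a =? j)%nat] => destruct (a =? j)%nat; simpl end;
      rewrite IH; ring.
Qed.

Lemma total_weight_iter w n i j :
  total_weight w n i j =
  Nat.iter n (first_step w) (fun h => total_weight w 0 h j) i.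
Proof.
  revert i; induction n as [|n IH]; intro i; [reflexivity|].
  rewrite total_weight_S. simpl. unfold first_step.
  destruct i; rewrite !IH; reflexivity.
Qed.

Lemma total_weight_short w n i : (n < i)%nat -> total_weight w n i 0 = 0.
Proof.
  revert i; induction n as [|n IH]; intros [|i] Hi; try lia.
  - apply total_weight_0.
  - rewrite total_weight_S. unfold first_step. rewrite !IH by lia. ring.
Qed.

(** [i] steps are just enough to descend from [i], so the only path is the
    straight one. *)
Lemma total_weight_straight_down w c i :
  (forall k, down_weight w k = c * (INR k + 1)) ->
  total_weight w i i 0 = INR (fact i) * c ^ i.
Proof.
  intro H; induction i as [|i IH].
  - rewrite total_weight_0. simpl. ring.
  - rewrite total_weight_S. unfold first_step.
    rewrite !total_weight_short by lia. rewrite IH, H, fact_simpl, mult_INR, S_INR.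
    simpl. ring.
Qed.

(** A path from above [S m] to 0 is cut at its first step from [S m] to [m]; what
    precedes it is a path of the raised model [w'].  In the induction on [n],
    that cut occurs at the very first step only if [h = 0], which is the
    term [u n * v 0] of [convolution_S]. *)
Lemma first_passage w w' m n h :
  (forall k, up_weight w (S m + k) = up_weight w' k) ->
  (forall k, level_weight w (S m + k) = level_weight w' k) ->
  (forall k, down_weight w (S m + k) = down_weight w' k) ->
  total_weight w n (S m + h) 0 =
  down_weight w m *
  convolution (fun k => total_weight w k m 0) (fun k => total_weight w' k h 0) n.
Proof.
  intros Hu Hl Hd. revert h; induction n as [|n IH]; intro h.
  - rewrite total_weight_0. simpl. ring.
  - rewrite total_weight_S, convolution_S, total_weight_0. unfold first_step.
    rewrite <- Nat.add_succ_r, Hu, Hl, !IH.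
    destruct h as [|h].
    + rewrite (convolution_lincomb _ (fun k => total_weight w' k 1 0)
        (fun k => total_weight w' k 0 0) (fun _ => 0)
        (up_weight w' 0) (level_weight w' 0) 0 (shift 1 _)).
      * rewrite Nat.add_0_r. simpl. ring.
      * intro j. unfold shift; simpl Nat.add.
        rewrite total_weight_S. unfold first_step. ring.
    + rewrite (convolution_lincomb _ (fun k => total_weight w' k (S (S h)) 0)
        (fun k => total_weight w' k (S h) 0) (fun k => total_weight w' k h 0)
        (up_weight w' (S h)) (level_weight w' (S h)) (down_weight w' h) (shift 1 _)).
      * replace (S m + S h)%nat with (S (S m + h)) by lia. cbv iota.
        rewrite Hd, IH. cbn [Nat.eqb]. ring.
      * intro j. unfold shift; simpl Nat.add.
        rewrite total_weight_S. unfold first_step. ring.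
Qed.

Definition linear_growth (M : R) (w : step_weights) : Prop :=
  forall k, Rabs (up_weight w k) <= M * INR (S k) /\
            Rabs (level_weight w k) <= M * INR (S k) /\
            Rabs (down_weight w k) <= M * INR (S k).

(** From height [i], the height is at most [i + k] after [k] steps, so the
    weights along a path of length [n] multiply to at most
    [M ^ n * (i + 1) * ... * (i + n)], and there are at most [3 ^ n] paths. *)
Lemma iter_first_step_bound M w K u n i :
  0 <= M -> linear_growth M w -> (forall h, Rabs (u h) <= K) ->
  INR (fact i) * Rabs (Nat.iter n (first_step w) u i) <=
  K * (3 * M) ^ n * INR (fact (i + n)).
Proof.
  intros HM Hw Hu.
  assert (HK : 0 <= K) by (eapply Rle_trans; [apply Rabs_pos | apply (Hu 0%nat)]).
  revert i; induction n as [|n IH]; intro i.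
  - simpl. rewrite Nat.add_0_r, Rmult_1_r, Rmult_comm.
    apply Rmult_le_compat_r; [apply pos_INR | apply Hu].
  - simpl Nat.iter. set (v := Nat.iter n (first_step w) u) in *.
    set (c := K * (3 * M) ^ n) in *.
    assert (Hc : 0 <= c) by (apply Rmult_le_pos; [lra | apply pow_le; lra]).
    replace (K * (3 * M) ^ S n) with (3 * (M * c)) by (unfold c; simpl; ring).
    (* [a] is the weight of a step from [i] to [k], at most [M * p]. *)
    assert (Hstep : forall a k p, Rabs a <= M * INR p ->
              (fact i * p * fact (k + n) <= fact k * fact (i + S n))%nat ->
              INR (fact i) * Rabs (a * v k) <= M * c * INR (fact (i + S n))).
    { intros a k p Ha Hf. specialize (IH k).
      pose proof (INR_fact_lt_0 k) as Hk. pose proof (pos_INR (fact i)).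
      apply le_INR in Hf. rewrite !mult_INR in Hf.
      apply Rmult_le_reg_l with (INR (fact k)); [exact Hk|].
      rewrite Rabs_mult.
      replace (INR (fact k) * (INR (fact i) * (Rabs a * Rabs (v k))))
        with (INR (fact i) * Rabs a * (INR (fact k) * Rabs (v k))) by ring.
      eapply Rle_trans.
      - apply Rmult_le_compat; [apply Rmult_le_pos; [lra | apply Rabs_pos]
          | apply Rmult_le_pos; [lra | apply Rabs_pos]
          | apply Rmult_le_compat_l; [lra | apply Ha] | apply IH].
      - replace (INR (fact i) * (M * INR p) * (c * INR (fact (k + n))))
          with (M * c * (INR (fact i) * INR p * INR (fact (k + n)))) by ring.
        replace (INR (fact k) * (M * c * INR (fact (i + S n))))
          with (M * c * (INR (fact k) * INR (fact (i + S n)))) by ring.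
        apply Rmult_le_compat_l; [apply Rmult_le_pos; lra | exact Hf]. }
    destruct (Hw i) as [Hup [Hlev _]].
    unfold first_step.
    assert (Hup' := Hstep _ (S i) _ Hup).
    assert (Hlev' := Hstep _ i _ Hlev).
    assert (Hdown' : INR (fact i) *
       Rabs (match i with O => 0 | S k => down_weight w k * v k end)
       <= M * c * INR (fact (i + S n))).
    { destruct i as [|k].
      - rewrite Rabs_R0, Rmult_0_r. apply Rmult_le_pos; [|apply pos_INR].
        apply Rmult_le_pos; lra.
      - apply (Hstep _ k (S k)); [apply Hw|].
        replace (S k + S n)%nat with (S (S (k + n))) by lia.
        rewrite !fact_simpl. pose proof (lt_O_fact k). pose proof (lt_O_fact (k + n)).
        assert (S k * S k <= S (S (k + n)) * S (k + n))%nat by nia.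
        nia. }
    specialize (Hup' ltac:(replace (S i + n)%nat with (i + S n)%nat by lia;
                           rewrite (fact_simpl i); lia)).
    specialize (Hlev' ltac:(replace (i + S n)%nat with (S (i + n)) by lia;
       rewrite (fact_simpl (i + n)); pose proof (lt_O_fact i);
       pose proof (lt_O_fact (i + n));
       assert (S i <= S (i + n))%nat by lia; nia)).
    eapply Rle_trans.
    + apply Rmult_le_compat_l; [apply pos_INR|].
      eapply Rle_trans; [apply Rabs_triang|].
      apply Rplus_le_compat_r, Rabs_triang.
    + lra.
Qed.

Lemma factorial_bound_iter M w K u i :
  0 <= M -> linear_growth M w -> (forall h, Rabs (u h) <= K) ->
  factorial_bound (K * 2 ^ i) (6 * M) (fun n => Nat.iter n (first_step w) u i).
Proof.
  intros HM Hw Hu.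
  assert (HK : 0 <= K) by (eapply Rle_trans; [apply Rabs_pos | apply (Hu 0%nat)]).
  split; [apply Rmult_le_pos; [lra | apply pow_le; lra]|].
  intro n. pose proof (INR_fact_lt_0 i).
  apply Rmult_le_reg_l with (INR (fact i)); [assumption|].
  eapply Rle_trans; [apply (iter_first_step_bound M w K); assumption|].
  eapply Rle_trans.
  - apply Rmult_le_compat_l; [|apply INR_fact_add_le].
    apply Rmult_le_pos; [lra | apply pow_le; lra].
  - apply Req_le. replace (6 * M) with (2 * (3 * M)) by ring.
    rewrite (Rpow_mult_distr 2), pow_add. ring.
Qed.

Lemma factorial_bound_total_weight M w i j :
  0 <= M -> linear_growth M w ->
  factorial_bound (2 ^ i) (6 * M) (fun n => total_weight w n i j).
Proof.
  intros HM Hw.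
  destruct (factorial_bound_iter M w 1 (fun h => total_weight w 0 h j) i HM Hw)
    as [H1 H2].
  - intro h. rewrite total_weight_0. destruct (h =? j)%nat; rewrite ?Rabs_R0, ?Rabs_R1; lra.
  - rewrite Rmult_1_l in *. split; [exact H1|]. intro n.
    rewrite total_weight_iter. apply H2.
Qed.

(** * Solutions of the backward equation *)

(** This turns a sequence of successive derivatives, which is how solutions of a
    differential system present themselves, into iterated derivatives. *)
Lemma Derive_n_chain (D : nat -> R -> R) delta :
  (forall n t, Rabs t < delta -> is_derive (D n) t (D (S n) t)) ->
  forall n t, Rabs t < delta ->
  Derive_n (D 0%nat) n t = D n t /\ ex_derive_n (D 0%nat) n t.
Proof.
  intros H n; induction n as [|n IH]; intros t Ht; [split; simpl; trivial|].
  assert (Hloc : locally t (fun y => D n y = Derive_n (D 0%nat) n y)).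
  { apply (radius_locally _ delta); [exact Ht|].
    intros y Hy. symmetry; apply IH, Hy. }
  assert (Hd : is_derive (Derive_n (D 0%nat) n) t (D (S n) t))
    by (eapply is_derive_ext_loc; [exact Hloc | apply H, Ht]).
  split; [simpl; apply is_derive_unique, Hd | eexists; exact Hd].
Qed.

(** Lagrange's remainder of order [n] is at most [K * (r * t) ^ n]. *)
Lemma Taylor_egf_pos (D : nat -> R -> R) delta K r t :
  0 < r ->
  (forall n s, Rabs s < delta -> is_derive (D n) s (D (S n) s)) ->
  (forall s, Rabs s < delta -> factorial_bound K r (fun n => D n s)) ->
  0 < t < delta -> 2 * (r * t) <= 1 ->
  D 0%nat t = egf (fun n => D n 0) t.
Proof.
  intros Hr HD Hb Ht Hrt.
  set (v := fun n => D n 0).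
  assert (Hb0 : factorial_bound K r v) by (apply Hb; rewrite Rabs_R0; lra).
  assert (HK := proj1 Hb0).
  set (S_ n := sum_n (fun k => scal (pow_n t k) (exp_coeff v k)) n).
  assert (H1 : is_lim_seq S_ (egf v t)).
  { apply PSeries_correct, CV_radius_inside.
    eapply egf_radius; [exact Hr | exact Hb0 | rewrite Rabs_pos_eq; lra]. }
  assert (H2 : is_lim_seq S_ (D 0%nat t)).
  { assert (Hgeo : is_lim_seq (fun n => K * (1 / 2) ^ n) 0).
    { replace (Finite 0) with (Rbar_mult K 0) by (simpl; f_equal; ring).
      apply is_lim_seq_scal_l, is_lim_seq_geom. rewrite Rabs_pos_eq; lra. }
    assert (Hdiff : is_lim_seq (fun n => D 0%nat t - S_ n) 0).
    { apply is_lim_seq_abs_0.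
      apply is_lim_seq_le_le with (fun _ => 0) (fun n => K * (1 / 2) ^ n);
        [|apply is_lim_seq_const | exact Hgeo].
      intro n; split; [apply Rabs_pos|].
      destruct (Taylor_Lagrange (D 0%nat) n 0 t (proj1 Ht)) as [z [Hz HT]].
      { intros s Hs k _. apply (Derive_n_chain D delta HD).
        rewrite Rabs_pos_eq; lra. }
      assert (HS : S_ n = sum_f_R0 (fun m => (t - 0) ^ m / INR (fact m) *
                                     Derive_n (D 0%nat) m 0) n).
      { unfold S_. rewrite sum_n_Reals. apply sum_eq; intros k _.
        rewrite (proj1 (Derive_n_chain D delta HD k 0 ltac:(rewrite Rabs_R0; lra))).
        rewrite pow_n_pow, Rminus_0_r. unfold exp_coeff, scal; simpl.
        unfold mult; simpl. unfold v, Rdiv. ring. }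
      rewrite HT, <- HS.
      rewrite (proj1 (Derive_n_chain D delta HD (S n) z ltac:(rewrite Rabs_pos_eq; lra))).
      rewrite Rminus_0_r.
      replace (S_ n + t ^ S n / INR (fact (S n)) * D (S n) z - S_ n)
        with (t ^ S n / INR (fact (S n)) * D (S n) z) by ring.
      destruct (Hb z) as [_ Hbz]; [rewrite Rabs_pos_eq; lra|].
      specialize (Hbz (S n)). pose proof (INR_fact_lt_0 (S n)) as Hf.
      assert (Hp : 0 < t ^ S n) by (apply pow_lt; lra).
      assert (Hq : 0 < t ^ S n / INR (fact (S n))) by (apply Rdiv_lt_0_compat; lra).
      rewrite Rabs_mult, (Rabs_pos_eq (_ / _)) by lra.
      eapply Rle_trans; [apply Rmult_le_compat_l; [lra | exact Hbz]|].
      replace (t ^ S n / INR (fact (S n)) * (K * r ^ S n * INR (fact (S n))))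
        with (K * (r * t) ^ S n) by (rewrite Rpow_mult_distr; field; lra).
      apply Rmult_le_compat_l; [lra|].
      assert (0 <= r * t) by nra.
      eapply Rle_trans; [apply pow_incr with (y := 1 / 2); lra|].
      simpl. assert (0 < (1 / 2) ^ n) by (apply pow_lt; lra). lra. }
    apply is_lim_seq_ext with (fun n => D 0%nat t - (D 0%nat t - S_ n));
      [intro; ring|].
    apply is_lim_seq_minus with (D 0%nat t) 0;
      [apply is_lim_seq_const | exact Hdiff |].
    unfold is_Rbar_minus, is_Rbar_plus; simpl. do 2 f_equal. ring. }
  apply is_lim_seq_unique in H1. apply is_lim_seq_unique in H2.
  rewrite H1 in H2. injection H2. intro E; symmetry; exact E.
Qed.

(** Negative [t] is reduced to [- t] by reflecting [D]. *)
Lemma Taylor_egf (D : nat -> R -> R) delta K r t :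
  0 < r ->
  (forall n s, Rabs s < delta -> is_derive (D n) s (D (S n) s)) ->
  (forall s, Rabs s < delta -> factorial_bound K r (fun n => D n s)) ->
  Rabs t < delta -> 2 * (r * Rabs t) <= 1 ->
  D 0%nat t = egf (fun n => D n 0) t.
Proof.
  intros Hr HD Hb Ht Hrt.
  destruct (Rtotal_order t 0) as [Hneg|[->|Hpos]].
  - rewrite Rabs_left in Ht, Hrt by lra.
    set (D' n s := (-1) ^ n * D n (- s)).
    assert (E : D' 0%nat (- t) = egf (fun n => D' n 0) (- t)).
    { apply (Taylor_egf_pos D' delta K r); [exact Hr | | | lra | lra].
      - intros n s Hs. unfold D'. evar_last.
        + apply is_derive_scal. apply (is_derive_comp (D n) Ropp).
          * apply HD. rewrite Rabs_Ropp; exact Hs.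
          * auto_derive; [trivial | reflexivity].
        + unfold scal; simpl; unfold mult; simpl. ring.
      - intros s Hs. destruct (Hb (- s)) as [H0 H1]; [rewrite Rabs_Ropp; exact Hs|].
        split; [exact H0|]. intro n. unfold D'.
        rewrite Rabs_mult, pow_1_abs, Rmult_1_l. apply H1. }
    unfold D' in E at 1. rewrite Ropp_involutive, Rmult_1_l in E. rewrite E.
    unfold egf, PSeries. apply Series_ext; intro n. unfold D', exp_coeff.
    rewrite Ropp_0. replace (- t) with (-1 * t) by ring.
    rewrite Rpow_mult_distr. pose proof (INR_fact_lt_0 n).
    replace ((-1) ^ n * D n 0 / INR (fact n) * ((-1) ^ n * t ^ n))
      with (((-1) ^ n * (-1) ^ n) * (D n 0 / INR (fact n) * t ^ n))
      by (field; lra).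
    rewrite <- Rpow_mult_distr. replace (-1 * -1) with 1 by ring.
    rewrite pow1. apply Rmult_1_l.
  - rewrite egf_0. reflexivity.
  - rewrite Rabs_pos_eq in Ht, Hrt by lra.
    apply (Taylor_egf_pos D delta K r); lra || assumption.
Qed.

Lemma is_derive_first_step w (u : nat -> R -> R) (du : nat -> R) t i :
  (forall h, is_derive (u h) t (du h)) ->
  is_derive (fun t => first_step w (fun h => u h t) i) t (first_step w du i).
Proof.
  intro H. unfold first_step.
  apply @is_derive_plus; [apply @is_derive_plus|].
  - apply is_derive_scal, H.
  - apply is_derive_scal, H.
  - destruct i as [|k]; [apply @is_derive_const | apply is_derive_scal, H].
Qed.

(** The differential system is the backward equation of the walk, so the [n]-th
    derivative at 0 is the [n]-fold first-step operator applied to the initial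
    values.  Linear growth of the weights bounds that derivative by a constant
    times [(6 * M) ^ n * n!], which is what makes the bounded solution unique. *)
Lemma bounded_solution_egf M w K delta (F : nat -> R -> R) i t :
  0 < M -> linear_growth M w ->
  (forall s, Rabs s < delta -> forall h,
     is_derive (F h) s (first_step w (fun k => F k s) h)) ->
  (forall s, Rabs s < delta -> forall h, Rabs (F h s) <= K) ->
  (forall h, F h 0 = total_weight w 0 h 0) ->
  Rabs t < delta -> 12 * M * Rabs t <= 1 ->
  F i t = egf (fun n => total_weight w n i 0) t.
Proof.
  intros HM Hw HF HK H0 Ht HMt.
  set (D n s := Nat.iter n (first_step w) (fun h => F h s) i).
  assert (HD : forall n h s, Rabs s < delta ->
    is_derive (fun s => Nat.iter n (first_step w) (fun k => F k s) h) s
      (Nat.iter (S n) (first_step w) (fun k => F k s) h)).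
  { induction n as [|n IH]; intros h s Hs; [apply HF, Hs|].
    apply (is_derive_first_step w
      (fun k s => Nat.iter n (first_step w) (fun k => F k s) k)).
    intro k. apply IH, Hs. }
  change (F i t) with (D 0%nat t).
  rewrite (Taylor_egf D delta (K * 2 ^ i) (6 * M)).
  - apply egf_ext; intro n. unfold D. rewrite total_weight_iter.
    assert (Hext : forall n h, Nat.iter n (first_step w) (fun k => F k 0) h =
      Nat.iter n (first_step w) (fun k => total_weight w 0 k 0) h).
    { clear n. induction n as [|n IH]; intro h; [apply H0|].
      simpl. unfold first_step. destruct h; rewrite !IH; reflexivity. }
    apply Hext.
  - lra.
  - intros n s Hs. apply HD, Hs.
  - intros s Hs. apply factorial_bound_iter; [lra | exact Hw | apply HK, Hs].
  - exact Ht.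
  - lra.
Qed.

(** * The Riccati family *)

Lemma affine_growth a b k : Rabs (a * INR k + b) <= (Rabs a + Rabs b) * INR (S k).
Proof.
  eapply Rle_trans; [apply Rabs_triang|].
  rewrite Rabs_mult, (Rabs_pos_eq (INR k)), S_INR by apply pos_INR.
  pose proof (pos_INR k). pose proof (Rabs_pos a). pose proof (Rabs_pos b). nra.
Qed.

Lemma linear_growth_affine a b c d e f w :
  (forall k, up_weight w k = a * INR k + b) ->
  (forall k, level_weight w k = c * INR k + d) ->
  (forall k, down_weight w k = e * INR k + f) ->
  exists M, forall M', M <= M' -> linear_growth M' w.
Proof.
  intros Hu Hl Hd.
  exists (Rabs a + Rabs b + (Rabs c + Rabs d) + (Rabs e + Rabs f)).
  intros M' HM k. rewrite Hu, Hl, Hd.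
  pose proof (Rabs_pos a). pose proof (Rabs_pos b). pose proof (Rabs_pos c).
  pose proof (Rabs_pos d). pose proof (Rabs_pos e). pose proof (Rabs_pos f).
  repeat split; (eapply Rle_trans; [apply affine_growth|];
    apply Rmult_le_compat_r; [apply pos_INR | lra]).
Qed.

Lemma continuous_bound_near_0 (f : R -> R) :
  continuous f 0 -> f 0 = 0 -> locally 0 (fun t => Rabs (f t) <= 1).
Proof.
  intros Hc H0.
  assert (Hball : locally (f 0) (fun y => Rabs y <= 1)).
  { rewrite H0. apply (radius_locally _ 1); [rewrite Rabs_R0; lra|]. intros; lra. }
  exact (Hc _ Hball).
Qed.

(** Multiplying a power of [X] by the exponential turns the Riccati equation
    into the backward equation of the auxiliary walk. *)
Lemma riccati_family A B C alpha0 gamma0 m X :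
  riccati_solution A B C X ->
  let w := auxiliary_model A B C alpha0 gamma0 m in
  let F h t := X t ^ h *
    exp (RInt (fun u => (alpha0 - INR m * A) * X u + gamma0 - INR m * B) 0 t) in
  (forall h, F h 0 = total_weight w 0 h 0) /\
  exists delta K, 0 < delta /\
    (forall s, Rabs s < delta -> forall h,
       is_derive (F h) s (first_step w (fun k => F k s) h)) /\
    (forall s, Rabs s < delta -> forall h, Rabs (F h s) <= K).
Proof.
  intros [HX0 HX] w F.
  set (g := fun u => (alpha0 - INR m * A) * X u + gamma0 - INR m * B).
  set (G := (fun t => RInt g 0 t) : R -> R).
  assert (HG0 : G 0 = 0) by exact (RInt_point 0 g).
  split.
  { intro h. unfold F. fold g. change (RInt g 0 0) with (G 0).
    rewrite HG0, exp_0, HX0, total_weight_0.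
    destruct h; simpl; ring. }
  apply locally_0_radius in HX. destruct HX as [d1 [Hd1 HX]].
  assert (HXc : forall s, Rabs s < d1 -> continuous X s).
  { intros s Hs. apply (ex_derive_continuous (K := R_AbsRing) (V := R_NormedModule)).
    eexists; apply HX, Hs. }
  assert (Hg : forall s, Rabs s < d1 -> continuous g s).
  { intros s Hs. unfold g.
    apply (ex_derive_continuous (K := R_AbsRing) (V := R_NormedModule)).
    assert (ex_derive X s) by (eexists; apply HX, Hs).
    auto_derive; trivial. }
  assert (HG : forall s, Rabs s < d1 -> is_derive G s (g s)).
  { intros s Hs. apply (is_derive_RInt g G 0); [|apply Hg, Hs].
    apply (radius_locally _ d1); [exact Hs|]. intros y Hy.
    apply (RInt_correct g). apply (ex_RInt_continuous (V := R_CompleteNormedModule)).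
    intros z Hz. apply Hg. destruct (between_0_Rabs z y Hz). lra. }
  assert (HX1 := continuous_bound_near_0 X (HXc 0 ltac:(rewrite Rabs_R0; lra)) HX0).
  assert (HG1 : locally 0 (fun t => Rabs (G t) <= 1)).
  { apply continuous_bound_near_0; [|exact HG0].
    apply (ex_derive_continuous (K := R_AbsRing) (V := R_NormedModule)).
    eexists; apply HG. rewrite Rabs_R0; lra. }
  destruct (locally_0_radius _ (filter_and _ _ HX1 HG1)) as [d2 [Hd2 Hsmall]].
  exists (Rmin d1 d2), (exp 1). split; [apply Rmin_pos; assumption|]. split.
  - intros s Hs h. pose proof (Rmin_l d1 d2) as Hl.
    unfold F. evar_last.
    + apply (is_derive_mult (fun t => X t ^ h) (fun t => exp (G t))).
      * apply (is_derive_pow X h), HX. lra.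
      * apply (is_derive_comp exp G).
        -- apply is_derive_exp.
        -- apply HG. lra.
      * intros a b; apply Rmult_comm.
    + unfold plus, mult, scal; simpl. unfold mult; simpl. fold g. fold (G s).
      unfold first_step; simpl. unfold g.
      destruct h as [|h].
      * simpl. ring.
      * rewrite S_INR. simpl. ring.
  - intros s Hs h. pose proof (Rmin_r d1 d2) as Hr.
    destruct (Hsmall s ltac:(lra)) as [H1 H2].
    unfold F. fold g. fold (G s).
    rewrite Rabs_mult, <- RPow_abs.
    rewrite (Rabs_pos_eq (exp _)) by (left; apply exp_pos).
    assert (exp (G s) <= exp 1).
    { apply Rabs_le_between in H2. destruct (Rle_lt_or_eq_dec (G s) 1) as [h1|h1];
      [lra | left; apply exp_increasing, h1 | rewrite h1; lra]. }
    assert (Hp : Rabs (X s) ^ h <= 1 ^ h)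
      by (apply pow_incr; split; [apply Rabs_pos | exact H1]).
    rewrite pow1 in Hp. pose proof (exp_pos (G s)).
    pose proof (pow_le (Rabs (X s)) h (Rabs_pos _)). nra.
Qed.

Lemma riccati_family_egf A B C alpha0 gamma0 m X h :
  riccati_solution A B C X ->
  locally 0 (fun t =>
    X t ^ h *
    exp (RInt (fun u => (alpha0 - INR m * A) * X u + gamma0 - INR m * B) 0 t) =
    egf (fun n => total_weight (auxiliary_model A B C alpha0 gamma0 m) n h 0) t).
Proof.
  intro hX. set (aux := auxiliary_model A B C alpha0 gamma0 m).
  destruct (linear_growth_affine A (alpha0 - INR m * A) B (gamma0 - INR m * B)
              C C aux) as [M1 HM1];
    [intro; simpl; ring | intro; simpl; ring | intro; simpl; ring |].
  set (M := Rmax 1 M1). assert (HM : 1 <= M) by apply Rmax_l.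
  specialize (HM1 M (Rmax_r _ _)).
  destruct (riccati_family A B C alpha0 gamma0 m X hX)
    as [HF0 [d [K [Hd [HFd HFb]]]]].
  assert (Hi : 0 < / (12 * M)) by (apply Rinv_0_lt_compat; lra).
  apply (radius_locally _ (Rmin d (/ (12 * M)))).
  - rewrite Rabs_R0. apply Rmin_pos; assumption.
  - intros t Ht. pose proof (Rmin_l d (/ (12 * M))). pose proof (Rmin_r d (/ (12 * M))).
    apply (bounded_solution_egf M aux K d (fun h t => X t ^ h * exp (RInt (fun u =>
      (alpha0 - INR m * A) * X u + gamma0 - INR m * B) 0 t)));
      try assumption; try lra.
    rewrite <- (Rinv_r (12 * M)) by lra. apply Rmult_le_compat_l; lra.
Qed.

(** If [X t = 0] with [t] nonzero, the difference quotient is 0 although it tends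
    to [X'(0) = C > 0]. *)
Lemma riccati_nonzero A B C X :
  0 < C -> riccati_solution A B C X ->
  locally' 0 (fun t => X t <> 0).
Proof.
  intros HC [HX0 HX].
  apply locally_singleton in HX. rewrite HX0 in HX.
  replace (A * 0 ^ 2 + B * 0 + C) with C in HX by ring.
  apply is_derive_Reals in HX.
  destruct (HX C HC) as [d Hd].
  exists d. intros t Ht Hne Habs.
  change (Rabs (t - 0) < d) in Ht. rewrite Rminus_0_r in Ht.
  specialize (Hd t Hne Ht).
  rewrite Rplus_0_l, HX0, Habs in Hd.
  replace ((0 - 0) / t - C) with (- C) in Hd by (field; exact Hne).
  rewrite Rabs_Ropp, Rabs_pos_eq in Hd; lra.
Qed.

(** One power of [X] cancels in the quotient, and the right-hand side is
    continuous at 0, so it is also the removable value. *)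
Lemma L_fun_near_0 A B C alpha0 gamma0 m X :
  0 < C -> riccati_solution A B C X ->
  locally 0 (fun t => L_fun A B C alpha0 gamma0 (S m) X t =
    INR (S m) * C * (X t ^ m *
      exp (RInt (fun u => (alpha0 - INR (S m) * A) * X u + gamma0 - INR (S m) * B) 0 t))).
Proof.
  intros HC HX.
  set (H t := INR (S m) * C * (X t ^ m *
      exp (RInt (fun u => (alpha0 - INR (S m) * A) * X u + gamma0 - INR (S m) * B) 0 t))).
  assert (Hq : locally' 0 (fun t => L_quotient A B C alpha0 gamma0 (S m) X t = H t)).
  { generalize (riccati_nonzero A B C X HC HX). apply filter_imp.
    intros t Ht. unfold L_quotient, F_fun, H. simpl pow. field. exact Ht. }
  assert (Hlim : real (Lim (L_quotient A B C alpha0 gamma0 (S m) X) 0) = H 0).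
  { rewrite (Lim_ext_loc H).
    - rewrite (is_lim_unique H 0 (H 0)); [reflexivity|].
      apply is_lim_continuity. apply continuity_pt_filterlim.
      apply (ex_derive_continuous (K := R_AbsRing) (V := R_NormedModule)).
      unfold H. apply ex_derive_scal.
      destruct (riccati_family A B C alpha0 gamma0 (S m) X HX)
        as [_ [d [K [Hd [HD _]]]]].
      eexists. apply (HD 0); rewrite Rabs_R0; exact Hd.
    - revert Hq. apply filter_imp. intros t Ht. symmetry; exact Ht. }
  destruct Hq as [e He]. exists e. intros t Ht.
  unfold L_fun. destruct (Req_EM_T t 0) as [->|Hne].
  - exact Hlim.
  - apply He; assumption.
Qed.

(** * Functions represented by an exponential generating function *)

Lemma has_egf_radius f u : has_egf f u -> Rbar_lt 0 (CV_radius (exp_coeff u)).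
Proof.
  intro H. apply locally_0_radius in H. destruct H as [d [Hd H]].
  specialize (H (d / 2)). rewrite Rabs_pos_eq in H by lra.
  specialize (H ltac:(lra)).
  apply Rbar_lt_le_trans with (Finite (d / 2)); [simpl; lra|].
  apply Rbar_not_lt_le. intro Hlt.
  apply (CV_disk_outside (exp_coeff u) (d / 2)).
  - rewrite Rabs_pos_eq by lra. exact Hlt.
  - apply ex_series_lim_0.
    apply ex_pseries_R. eexists; exact H.
Qed.

(** Identity of power series needs positive radii, which
    [has_egf_radius] reads off from convergence at a single positive point. *)
Lemma has_egf_unique f u v : has_egf f u -> has_egf f v -> forall n, u n = v n.
Proof.
  intros Hu Hv n.
  assert (E : exp_coeff u n = exp_coeff v n).
  { apply PSeries_ext_recip.
    - apply (has_egf_radius f), Hu.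
    - apply (has_egf_radius f), Hv.
    - generalize (filter_and _ _ Hu Hv). apply filter_imp. intros t [H1 H2].
      rewrite (is_pseries_unique _ _ _ H1). symmetry.
      apply is_pseries_unique, H2. }
  unfold exp_coeff in E. pose proof (INR_fact_lt_0 n).
  apply Rmult_eq_reg_r in E; [exact E|]. apply Rinv_neq_0_compat. lra.
Qed.

Lemma has_egf_factorial_bound K r f u :
  0 < r -> factorial_bound K r u -> locally 0 (fun t => f t = egf u t) -> has_egf f u.
Proof.
  intros Hr Hu Hf.
  apply locally_0_radius in Hf. destruct Hf as [d [Hd Hf]].
  assert (Hir : 0 < / r) by (apply Rinv_0_lt_compat; lra).
  apply (radius_locally _ (Rmin d (/ r))).
  - rewrite Rabs_R0. apply Rmin_pos; assumption.
  - intros t Ht. pose proof (Rmin_l d (/ r)). pose proof (Rmin_r d (/ r)).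
    rewrite Hf by lra. apply PSeries_correct, CV_radius_inside.
    apply (egf_radius K r); [exact Hr | exact Hu|].
    rewrite <- (Rinv_r r) by lra. apply Rmult_lt_compat_l; lra.
Qed.

Lemma factorial_bound_scal K r u c :
  factorial_bound K r u -> factorial_bound (Rabs c * K) r (fun n => c * u n).
Proof.
  intros [H0 H]; split; [apply Rmult_le_pos; [apply Rabs_pos | exact H0]|].
  intro n. rewrite Rabs_mult, !Rmult_assoc, <- Rmult_assoc with (r1 := K).
  apply Rmult_le_compat_l; [apply Rabs_pos | apply H].
Qed.

Lemma row_sum_0 c n : row_sum c 0 n = c n 0%nat.
Proof. apply PSeries_0. Qed.

(** * The return recurrence *)

(** [first_passage] at its lowest start height, in a form that isolates the return
    weight of length [N]; all other return weights in it are shorter. *)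
Lemma return_weight_recurrence A B C alpha0 gamma0 m N :
  let aux := auxiliary_model A B C alpha0 gamma0 (S m) in
  let b := fun n => total_weight aux n m 0 in
  let W := return_weight A B C alpha0 gamma0 (INR (S m + 1) * C) in
  INR (S m) * C * b m = INR (fact (S m)) * C ^ S m /\
  total_weight aux (N + S m) (S m) 0 =
    INR (fact (S m)) * C ^ S m * W N +
    INR (S m) * C * convolution (shift (S m) b) W N.
Proof.
  intros aux b W.
  set (orig := original_model A B C alpha0 gamma0 (INR (S m + 1) * C)).
  assert (Hdown : forall k, down_weight aux k = C * (INR k + 1)) by reflexivity.
  assert (Hbm : INR (S m) * C * b m = INR (fact (S m)) * C ^ S m).
  { unfold b. rewrite (total_weight_straight_down aux C m Hdown).
    rewrite fact_simpl, mult_INR. simpl pow. ring. }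
  split; [exact Hbm|].
  rewrite <- (Nat.add_0_r (S m)) at 2.
  rewrite (first_passage aux orig m).
  - fold b. change (fun k => total_weight orig k 0 0) with W.
    rewrite convolution_leading_zeros
      by (intros k Hk; apply total_weight_short, Hk).
    rewrite <- Hbm, Hdown, (S_INR m). ring.
  - intro k. cbn [up_weight aux orig auxiliary_model original_model].
    rewrite plus_INR. ring.
  - intro k. cbn [level_weight aux orig auxiliary_model original_model].
    rewrite plus_INR. ring.
  - intro k. cbn [down_weight aux orig auxiliary_model original_model].
    rewrite !plus_INR. simpl (INR 1). ring.
Qed.

Theorem corollary3p3 (A B C alpha0 gamma0 beta0 : R) (m : nat) (X : R -> R)
    (hC : 0 < C) (hm : (1 <= m)%nat) (hbeta0 : beta0 = INR (m + 1) * C)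
    (hX : riccati_solution A B C X) :
  let Wn := return_weight A B C alpha0 gamma0 beta0 in
  let W := egf Wn in
  let an := aux_weight A B C alpha0 gamma0 m m in
  let bn := aux_weight A B C alpha0 gamma0 m (m - 1) in
  let a := bivariate_egf an in
  let b := bivariate_egf bn in
  let F := F_fun A B alpha0 gamma0 m X in
  let L := L_fun A B C alpha0 gamma0 m X in
  let K := INR (fact m) * C ^ m in
  (egf_converges Wn /\ egf_converges (row_sum an 0) /\
   egf_converges (row_sum bn 0) /\
   (exists f, has_egf F f) /\ (exists lambda, has_egf L lambda)) /\
  locally 0 (fun t =>
    W t = 1 / K *
      (Derive_n (fun u => a 0 u) m t
       - INR m * C *
         RInt (fun s => Derive_n (fun u => b 0 u) m (t - s) * W s) 0 t)) /\
  locally 0 (fun t =>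
    W t = 1 / K *
      (Derive_n F m t - RInt (fun s => Derive_n L m (t - s) * W s) 0 t)) /\
  (forall f lambda : nat -> R, has_egf F f -> has_egf L lambda ->
    lambda (m - 1)%nat = K /\
    Wn 0%nat = 1 /\
    forall N : nat, (1 <= N)%nat ->
      Wn N = 1 / K *
        (f (N + m)%nat
         - sum_n_m (fun q => lambda (m - 1 + q)%nat * Wn (N - q)%nat) 1 N)).
Proof.
  destruct m as [|m]; [lia|].
  replace (S m - 1)%nat with m by lia.
  intros Wn W an bn a b F L K.
  set (aux := auxiliary_model A B C alpha0 gamma0 (S m)).
  set (orig := original_model A B C alpha0 gamma0 beta0).
  set (a0 := fun n => total_weight aux n (S m) 0).
  set (b0 := fun n => total_weight aux n m 0).
  set (c := INR (S m) * C).
  assert (HKpos : 0 < K).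
  { apply Rmult_lt_0_compat; [apply INR_fact_lt_0 | apply pow_lt, hC]. }
  assert (Hb0m : c * b0 m = K)
    by apply (return_weight_recurrence A B C alpha0 gamma0 m 0).
  assert (Hrec : forall N, a0 (N + S m)%nat =
                           K * Wn N + c * convolution (shift (S m) b0) Wn N).
  { intro N. unfold Wn. rewrite hbeta0. apply return_weight_recurrence. }
  destruct (linear_growth_affine A (alpha0 - INR (S m) * A) B (gamma0 - INR (S m) * B)
              C C aux) as [M1 HM1];
    [intro; simpl; ring | intro; simpl; ring | intro; simpl; ring |].
  destruct (linear_growth_affine A alpha0 B gamma0 C beta0 orig) as [M2 HM2];
    [reflexivity | reflexivity | reflexivity |].
  set (M := Rmax 1 (Rmax M1 M2)).
  assert (HM : 1 <= M) by apply Rmax_l.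
  specialize (HM1 M (Rle_trans _ _ _ (Rmax_l _ _) (Rmax_r _ _))).
  specialize (HM2 M (Rle_trans _ _ _ (Rmax_r _ _) (Rmax_r _ _))).
  set (r := 6 * M). assert (Hr : 6 <= r) by (unfold r; lra).
  assert (Ha0b : factorial_bound (2 ^ S m) r a0)
    by (apply factorial_bound_total_weight; [lra | exact HM1]).
  assert (Hb0b : factorial_bound (2 ^ m) r b0)
    by (apply factorial_bound_total_weight; [lra | exact HM1]).
  assert (HWb : factorial_bound (2 ^ 0) r Wn)
    by (apply factorial_bound_total_weight; [lra | exact HM2]).
  (* Taking derivatives doubles the rate, so [2 * r] and [K1] serve both
     factors of the convolution integral. *)
  set (K1 := Rmax 1 (2 ^ m * (2 * r) ^ S m * INR (fact (S m)))).
  assert (Hsb : factorial_bound K1 (2 * r) (shift (S m) b0)).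
  { apply (factorial_bound_weaken _ _ (2 * r) (2 * r)
             _ (Rmax_r 1 _)); [lra|].
    apply factorial_bound_shift; [lra | exact Hb0b]. }
  assert (HWb1 : factorial_bound K1 (2 * r) Wn).
  { apply (factorial_bound_weaken (2 ^ 0) K1 r); [apply Rmax_l | lra | exact HWb]. }
  assert (Ha : forall u, a 0 u = egf a0 u) by (intro u; apply egf_ext, row_sum_0).
  assert (Hb : forall u, b 0 u = egf b0 u) by (intro u; apply egf_ext, row_sum_0).
  assert (Hir : 0 < / (16 * r)) by (apply Rinv_0_lt_compat; lra).
  assert (HFegf : locally 0 (fun t => F t = egf a0 t)) 
    by exact (riccati_family_egf A B C alpha0 gamma0 (S m) X (S m) hX).
  assert (HLegf : locally 0 (fun t => L t = c * egf b0 t)).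
  { generalize (filter_and _ _ (L_fun_near_0 A B C alpha0 gamma0 m X hC hX) 
      (riccati_family_egf A B C alpha0 gamma0 (S m) X m hX)).
    apply filter_imp. intros t [H1 H2]. unfold L. rewrite H1.
    apply (f_equal (Rmult c)), H2. }
  assert (HFhas : has_egf F a0)
    by (apply (has_egf_factorial_bound _ r _ _ ltac:(lra) Ha0b), HFegf).
  assert (HLhas : has_egf L (fun n => c * b0 n)).
  { apply (has_egf_factorial_bound (Rabs c * 2 ^ m) r); [lra | |].
    - apply factorial_bound_scal, Hb0b.
    - revert HLegf. apply filter_imp. intros t ->.
      unfold egf. rewrite <- (PSeries_scal c). apply PSeries_ext. intro n.
      unfold PS_scal, exp_coeff, scal; simpl; unfold mult; simpl.
      unfold Rdiv. ring. }
  destruct (locally_0_radius _ (filter_and _ _ HFegf HLegf)) as [d2 [Hd2 HFL]].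
  (* Rate [2 * r] in [is_RInt_egf_convolution] asks for [16 * r * |t| <= 1]. *)
  set (rho := Rmin d2 (/ (16 * r))).
  assert (Hrho : 0 < rho) by (apply Rmin_pos; assumption).
  assert (Hsmall : forall t, Rabs t < rho -> Rabs t < d2 /\ 16 * (r * Rabs t) <= 1).
  { intros t Ht. unfold rho in Ht.
    pose proof (Rmin_l d2 (/ (16 * r))). pose proof (Rmin_r d2 (/ (16 * r))).
    split; [lra|].
    assert (16 * r * Rabs t <= 16 * r * / (16 * r)) by (apply Rmult_le_compat_l; lra).
    rewrite Rinv_r in H1 by lra. lra. }
  assert (HDa : forall t, Rabs t < rho ->
    Derive_n (egf a0) (S m) t = egf (shift (S m) a0) t).
  { intros t Ht. destruct (Hsmall t Ht). apply Derive_n_egf.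
    apply (egf_radius (2 ^ S m) r); [lra | exact Ha0b | lra]. }
  assert (HDb : forall t, Rabs t < rho ->
    Derive_n (egf b0) (S m) t = egf (shift (S m) b0) t).
  { intros t Ht. destruct (Hsmall t Ht). apply Derive_n_egf.
    apply (egf_radius (2 ^ m) r); [lra | exact Hb0b | lra]. }
  assert (HI : forall t, Rabs t < rho ->
    is_RInt (fun s => egf (shift (S m) b0) (t - s) * W s) 0 t
            (egf (convolution (shift (S m) b0) Wn) t)).
  { intros t Ht. destruct (Hsmall t Ht).
    apply (is_RInt_egf_convolution K1 (2 * r)); [lra | exact Hsb | exact HWb1 | lra]. }
  assert (HW : forall t, Rabs t < rho -> W t = 1 / K *
    (egf (shift (S m) a0) t - c * egf (convolution (shift (S m) b0) Wn) t)).
  { intros t Ht. destruct (Hsmall t Ht).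
    replace (1 / K * (egf (shift (S m) a0) t -
                      c * egf (convolution (shift (S m) b0) Wn) t))
      with (1 / K * egf (shift (S m) a0) t +
            - (c / K) * egf (convolution (shift (S m) b0) Wn) t) by (field; lra).
    apply egf_lincomb.
    - intro n. unfold shift at 1. rewrite Nat.add_comm, Hrec. field. lra.
    - eapply egf_radius; [| apply (factorial_bound_shift (2 ^ S m) r);
        [lra | exact Ha0b] |]; lra.
    - eapply egf_radius; [| eapply factorial_bound_ext; [apply convolution_0 |
        apply (factorial_bound_convolution K1 (2 * r)); [lra | exact Hsb | exact HWb1]] |];
        lra. }
  split; [|split; [|split]].
  - assert (Hcv : forall k u, factorial_bound k r u -> egf_converges u).
    { intros k u Hu.
      assert (H : has_egf (egf u) u).
      { apply (has_egf_factorial_bound k r); [lra | exact Hu|].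
        apply filter_forall. reflexivity. }
      unfold egf_converges. unfold has_egf in H. revert H. apply filter_imp.
      intros t Ht. eexists; exact Ht. }
    split; [|split; [|split; [|split]]].
    + apply (Hcv _ _ HWb).
    + eapply Hcv, factorial_bound_ext; [|exact Ha0b]. intro n; symmetry; apply row_sum_0.
    + eapply Hcv, factorial_bound_ext; [|exact Hb0b]. intro n; symmetry; apply row_sum_0.
    + exists a0; exact HFhas.
    + eexists; exact HLhas.
  - apply (radius_locally _ rho); [rewrite Rabs_R0; exact Hrho|]. intros t Ht.
    rewrite (HW t Ht). do 2 f_equal.
    + rewrite (Derive_n_ext _ _ _ _ Ha). symmetry; apply HDa, Ht.
    + apply (f_equal (Rmult c)). symmetry. apply is_RInt_unique.
      eapply is_RInt_ext; [|apply HI, Ht]. intros s Hs.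
      destruct (between_0_Rabs s t) as [_ H2]; [lra|].
      rewrite (Derive_n_ext _ _ _ _ Hb), HDb by lra. reflexivity.
  - apply (radius_locally _ rho); [rewrite Rabs_R0; exact Hrho|]. intros t Ht.
    rewrite (HW t Ht). do 2 f_equal.
    + rewrite (Derive_n_ext_loc F (egf a0)).
      * symmetry; apply HDa, Ht.
      * apply (radius_locally _ d2); [apply Hsmall, Ht | apply HFL].
    + symmetry. apply is_RInt_unique.
      eapply is_RInt_ext; [|exact (is_RInt_scal _ _ _ c _ (HI t Ht))]. intros s Hs.
      destruct (between_0_Rabs s t) as [_ H2]; [lra|].
      rewrite (Derive_n_ext_loc L (fun t => c * egf b0 t)).
      * rewrite Derive_n_scal_l, HDb by lra.
        unfold scal; simpl; unfold mult; simpl. ring.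
      * apply (radius_locally _ d2); [apply Hsmall; lra | apply HFL].
  - intros f lambda Hf Hlambda.
    assert (Ef : forall n, f n = a0 n) by (apply (has_egf_unique F); assumption).
    assert (El : forall n, lambda n = c * b0 n) by exact (has_egf_unique L _ _ Hlambda HLhas).
    split; [|split].
    + rewrite El. exact Hb0m.
    + apply total_weight_0.
    + intros N _. rewrite Ef, Hrec.
      rewrite (sum_n_m_ext _ (fun q => mult c (b0 (m + q)%nat * Wn (N - q)%nat))).
      * rewrite (sum_n_m_mult_l (K := R_Ring)).
        rewrite <- convolution_shift_sum. unfold mult; simpl. field. lra.
      * intro q. rewrite El. unfold mult; simpl. ring.
Qed.
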